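(* Let $\mathcal{X}$ and $\mathcal{Y}$ be Polish spaces with their Borel $\sigma$-algebras, let $\gamma$ be a probability measure on $\mathcal{Y}$, let $\mu(dx|y)$ be a stochastic kernel on $\mathcal{X}$ given $\mathcal{Y}$, and let $F:\mathcal{X}\times\mathcal{Y}\to\mathbb{R}$ be Borel measurable and bounded from below. For $c\in(0,\infty)$ define $$\bar\Lambda_c^1=\frac1c\log\int_{\mathcal{Y}}\exp\left(\int_{\mathcal{X}}cF(x,y)\,\mu(dx|y)\right)\gamma(dy)\in(-\infty,\infty].$$ Then for every $c\in(0,\infty)$ and every probability measure $\theta$ on $\mathcal{Y}$, $$\int_{\mathcal{Y}}\int_{\mathcal{X}}F(x,y)\,\mu(dx|y)\,\theta(dy)\le\frac1c R(\theta\,\|\,\gamma)+\bar\Lambda_c^1 .$$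
   Context: For probability measures $\nu,\gamma$ on the same Polish space, the relative entropy is $R(\nu\|\gamma)=\int\log\left(\frac{d\nu}{d\gamma}\right)d\nu$ if $\nu$ is absolutely continuous with respect to $\gamma$ and $\log\frac{d\nu}{d\gamma}$ is $\nu$-integrable, and $R(\nu\|\gamma)=\infty$ otherwise. A stochastic kernel $\mu(dx|y)$ on $\mathcal{X}$ given $\mathcal{Y}$ is a family of probability measures on $\mathcal{X}$ indexed by $y\in\mathcal{Y}$, depending measurably on $y$. Integrals may take the value $+\infty$, with the conventions $e^{\infty}=\infty$ and $\log\infty=\infty$. *)

(* Defs.v *)
From HB Require Import structures.
From mathcomp Require Import all_boot all_order all_algebra.
From mathcomp Require Import all_classical all_reals all_analysis.

Set Implicit Arguments.
Unset Strict Implicit.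
Unset Printing Implicit Defensive.

Import Order.TTheory GRing.Theory Num.Theory.
Import numFieldNormedType.Exports.

Local Open Scope classical_set_scope.
Local Open Scope ring_scope.

Definition separable (T : topologicalType) : Prop :=
  exists2 D : set T, countable D & dense D.

(* Convergence is written [exists l, F --> l] because the library's [cvg]
   requires a pointed space. *)
Definition complete_metric (R : realType) (M : metricType R) : Prop :=
  forall F : set_system M, ProperFilter F -> cauchy F -> exists l : M, F --> l.

Definition homeomorphic (T U : topologicalType) : Prop :=
  exists (f : T -> U) (g : U -> T),
    [/\ cancel f g, cancel g f, continuous f & continuous g].

(* The complete metric is existentially quantified: being Polish is a property
   of the topology. *)
Definition polish (R : realType) (T : topologicalType) : Prop :=
  separable T /\
  exists2 M : metricType R, complete_metric M & homeomorphic T M.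

(* [T] equipped with its Borel sigma-algebra. Applied to a product space this
   is generated by the open sets of the product topology, which is a priori
   larger than the library's product sigma-algebra. *)
Notation borel T := (g_sigma_algebraType (@open T)).

Section entropy.
Local Open Scope ereal_scope.
Local Open Scope charge_scope.

(* The Radon-Nikodym derivative takes a charge as first argument, hence the
   coercion of [nu] by [charge_of_finite_measure]. [lne] is the extended
   logarithm, equal to -oo on nonpositive arguments; the derivative is positive
   [nu]-almost everywhere. *)
Definition log_density d (T : measurableType d) (R : realType)
    (nu gamma : probability T R) : T -> \bar R :=
  fun x => lne (('d (charge_of_finite_measure nu) '/d gamma) x).

Definition relative_entropy d (T : measurableType d) (R : realType)
    (nu gamma : probability T R) : \bar R :=
  if `[< nu `<< gamma /\ nu.-integrable setT (log_density nu gamma) >]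
  then \int[nu]_x log_density nu gamma x
  else +oo.

Definition Lambda_bar1 d d' (X : measurableType d) (Y : measurableType d')
    (R : realType) (gamma : probability Y R) (mu : R.-pker Y ~> X)
    (F : X * Y -> R) (c : R) : \bar R :=
  c^-1%:E * lne (\int[gamma]_y expeR (\int[mu y]_x (c * F (x, y))%:E)).

End entropy.

(* Main.v *)
(** Put H(y) = int F(x,y) mu(dx|y), h = c H, Z = int e^h dgamma and
    D = log (dtheta/dgamma).  If Z and the relative entropy are finite, then
    k = e^(h - D) / Z satisfies int k dtheta <= int (e^h / Z) dgamma = 1, and
    1 + t <= e^t gives h <= D + log Z + k - 1 theta-almost everywhere.
    Integrating, int h dtheta <= R(theta || gamma) + log Z.

    Measurability of H relies on X and Y being second countable, so that the
    Borel sets of X * Y lie in the product sigma-algebra. *)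

Require Import Defs.
From HB Require Import structures.
From mathcomp Require Import all_boot all_order all_algebra.
From mathcomp Require Import all_classical all_reals all_analysis.
From mathcomp Require Import measurable_realfun ring lra.

Set Implicit Arguments.
Unset Strict Implicit.
Unset Printing Implicit Defensive.

Import Order.TTheory GRing.Theory Num.Theory.
Import numFieldNormedType.Exports.

Local Open Scope classical_set_scope.
Local Open Scope ring_scope.
Local Open Scope ereal_scope.

(** * Countable bases and measurability on a product of Polish spaces *)

(** The base consists of the preimages, under the homeomorphism [f], of the interiors of balls of
    radius 1/(n+1) centred at the points of a countable dense set. *)
Lemma polish_second_countable (R : realType) (T : topologicalType) :
  polish R T -> @second_countable T.
Proof.
move=> [[D cD dD] [M _ [f [g [fK gK cf cg]]]]].
have invn_gt0 n : (0 < n.+1%:R^-1 :> R)%R by rewrite invr_gt0.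
pose V (p : T * nat) := f @^-1` (ball (f p.1) (p.2.+1%:R^-1 : R))°.
exists (V @` (D `*` setT)); last split.
- by apply: (card_le_trans (card_image_le _ _)); exact: countableX.
- move=> _ [p _ <-]; apply: open_comp; last exact: open_interior.
  by move=> *; exact: cf.
move=> x A Ax.
have : nbhs (f x) (g @^-1` A) by apply: cg; rewrite fK.
move=> /nbhs_ballP[e /= e0 eA].
(* With 1/(N+1) < e/2 and a dense point [d] within half of 1/(N+1) of [x], the ball of radius
   1/(N+1) about [d] has [x] in its interior and stays within distance [e] of [x]. *)
have [//|N] := @ltr_add_invr R 0%R (e / 2)%R _; first by rewrite divr_gt0.
rewrite add0r => Ne.
have N2 : (0 < N.+1%:R^-1 / 2 :> R)%R by rewrite divr_gt0.
pose O := f @^-1` (ball (f x) (N.+1%:R^-1 / 2 : R))°.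
have Ox : O x by exact: nbhsx_ballx.
have oO : open O.
  by apply: open_comp; [move=> *; exact: cf|exact: open_interior].
have [d [Od Dd]] : O `&` D !=set0 by apply: dD => //; exists x.
have xd : ball (f x) (N.+1%:R^-1 / 2 : R) (f d) by exact: interior_subset Od.
exists (V (d, N)).
  split; first by exists (d, N).
  rewrite /V /= /interior; near=> y.
  rewrite [X in ball _ X](splitr (N.+1%:R^-1)).
  apply: (@ball_triangle _ _ (f x)); first exact: ball_sym.
  by near: y; exact: nbhsx_ballx.
move=> y /interior_subset /= dy; rewrite -(fK y); apply: eA => /=.
rewrite (splitr e); apply: (@ball_triangle _ _ (f d)).
  apply: le_ball xd; apply: ltW; apply: le_lt_trans Ne.
  by rewrite ler_pdivrMr// ler_peMr// ?ler1n// ltW.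
by apply: le_ball dy; exact: ltW.
Unshelve. all: by end_near. Qed.

(** An open set is the union of the basic rectangles that it contains, and there are only countably
    many of these. *)
Lemma open_prod_measurable (X Y : ptopologicalType) :
  @second_countable X -> @second_countable Y ->
  forall U : set (X * Y), open U -> measurable (U : set (borel X * borel Y)).
Proof.
move=> [BX cX [oX bX]] [BY cY [oY bY]] U oU.
pose I := (BX `*` BY) `&` [set p | p.1 `*` p.2 `<=` U].
have cI : countable I.
  apply: (@sub_countable _ _ _ (BX `*` BY)); last exact: countableX.
  by apply: subset_card_le => p [].
have -> : U = \bigcup_(p in I) (p.1 `*` p.2).
  apply/seteqP; split => [[x y] Uxy|z [p [_ pU]] /pU//].
  have : nbhs (x, y) U by rewrite nbhsE; exists U.
  move=> [[A B] /= [/bX [A' [BXA' A'x] A'A] /bY [B' [BYB' B'y] B'B]] AB].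
  exists (A', B'); last by [].
  by split => //= -[a b] /= [/A'A Aa /B'B Bb]; exact: AB.
rewrite bigcup_set_type; apply: countable_bigcupT_measurable.
  by rewrite (eq_countable (card_setT _)).
move=> [p /= /set_mem[[p1 p2] _]].
by apply: measurableX; apply: sub_sigma_algebra; [exact: oX|exact: oY].
Qed.

(** Lets a function that is Borel for the product topology be integrated against kernels, which
    calls for the product sigma-algebra. *)
Lemma measurable_fun_borel_prod (X Y : ptopologicalType) :
  @second_countable X -> @second_countable Y ->
  forall d (T : measurableType d) (f : X * Y -> T),
  measurable_fun [set: borel (X * Y)%type] (f : borel (X * Y)%type -> T) ->
  measurable_fun [set: borel X * borel Y] (f : borel X * borel Y -> T).
Proof.
move=> sX sY d T f mf.
have mid : measurable_fun [set: borel X * borel Y]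
    (id : borel X * borel Y -> borel (X * Y)%type).
  apply: (@measurability _ _ (borel X * borel Y)%type (borel (X * Y)%type) setT
    id (@open (X * Y)%type) erefl).
  move=> _ [U oU <-]; rewrite setTI; exact: open_prod_measurable.
exact: (measurableT_comp mf mid).
Qed.

(** * Exponentials and integrals of extended real functions bounded below *)

(** The preimage of the ray from [r] to infinity is the ray starting at [lne r]; for [r <= 0] this
    is everything, as [lne r] is then [-oo]. *)
Lemma measurable_expeR (R : realType) : measurable_fun [set: \bar R] (@expeR R).
Proof.
apply: (measurability _ (ErealGenCInfty.measurableE R)).
move=> _ [_ [r ->] <-]; rewrite setTI.
have lneE x : (r%:E <= expeR x) = (lne r%:E <= x).
  have [r0|r0] := leP r 0%R.
    by rewrite le0_lneNy// leNye (le_trans _ (expeR_ge0 x)).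
  by rewrite -[RHS]lee_expeR lneK// in_itv/= lee_fin ltW// leey.
have -> : expeR @^-1` `[r%:E, +oo[%classic = [set x | lne r%:E <= x].
  by apply/seteqP; split => x /=; rewrite in_itv/= andbT lneE.
by rewrite -[X in measurable X]setTI; exact: emeasurable_fun_c_infty.
Qed.

(** Here [m] may be negative and [g] need not be integrable. If the integral of [g] is infinite, the
    negative part of [g + m] still has integral at most [|m|], so both sides are [+oo]. *)
Lemma ge0_integralD_cst d (T : measurableType d) (R : realType)
    (P : {measure set T -> \bar R}) (g : T -> \bar R) (m : R) :
  P [set: T] = 1 -> (forall x, 0 <= g x) -> measurable_fun [set: T] g ->
  \int[P]_x (g x + m%:E) = \int[P]_x g x + m%:E.
Proof.
move=> P1 g0 mg.
have Pcst r : \int[P]_x r%:E = r%:E.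
  by rewrite -[RHS]mule1 -P1; exact: (integral_cst P measurableT).
have icst r : P.-integrable [set: T] (fun=> r%:E).
  by apply/integrableP; split => //; rewrite [ltLHS]Pcst ltry.
have [gy|gfin] := eqVneq (\int[P]_x g x) +oo; last first.
  rewrite integralD//; first by rewrite Pcst.
  apply/integrableP; split => //.
  under eq_integral do rewrite gee0_abs//.
  by rewrite ltey.
have mgm : measurable_fun [set: T] (fun x => g x + m%:E).
  exact: emeasurable_funD.
rewrite gy addye// integralE.
have neg : \int[P]_x (fun x => g x + m%:E)^\- x <= `|m|%:E.
  rewrite -[leRHS]Pcst; apply: ge0_le_integral => //.
    exact: measurable_funeneg.
  move=> x _; rewrite funenegE ge_max lee_fin normr_ge0 andbT leeNl.
  rewrite -EFinN (le_trans (y := m%:E))// ?leeDr// lee_fin.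
  exact: lerNnormlW.
(* Integrating [g <= (g + m)^+ + |m|] forces the positive part to have infinite integral. *)
have pos : \int[P]_x (fun x => g x + m%:E)^\+ x = +oo.
  have : +oo <= \int[P]_x (fun x => g x + m%:E)^\+ x + `|m|%:E.
    rewrite -gy -[X in _ <= _ + X]Pcst -ge0_integralD//.
    - apply: ge0_le_integral => //.
        by apply: emeasurable_funD => //; exact: measurable_funepos.
      move=> x _; rewrite funeposE.
      apply: (@le_trans _ _ (g x + m%:E + `|m|%:E)).
        rewrite -addeA -EFinD leeDl// lee_fin.
        by rewrite -lerBlDr sub0r lerNnormlW.
      by apply: leeD => //; rewrite le_max lexx.
    - exact: measurable_funepos.
  by case: (\int[P]_x _) => [r| |].
rewrite pos addye//.
by rewrite gt_eqF// lteNr /= (le_lt_trans neg)// ltry.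
Qed.

Lemma integral_probability_cst d (T : measurableType d) (R : realType)
    (P : probability T R) (r : R) : \int[P]_x r%:E = r%:E.
Proof.
rewrite -[RHS]mule1 -(probability_setT P).
exact: (integral_cst P measurableT).
Qed.

Lemma integral_expeR_gt0 d (T : measurableType d) (R : realType)
    (P : probability T R) (h : T -> \bar R) (m : R) :
  measurable_fun [set: T] h -> (forall y, m%:E <= h y) ->
  0 < \int[P]_y expeR (h y).
Proof.
move=> mh hm; apply: (@lt_le_trans _ _ (\int[P]_y (expR m)%:E)).
  by rewrite integral_probability_cst lte_fin expR_gt0.
apply: ge0_le_integral => //.
- by apply: measurableT_comp => //; exact: measurable_expeR.
- by move=> x _; rewrite -[leLHS]/(expeR m%:E) lee_expeR.
Qed.

(** * The Gibbs variational inequality *)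

Lemma lne_gtNy (R : realType) (x : \bar R) : 0 < x -> -oo < lne x.
Proof. by move=> x0; rewrite -lte_expeR lneK// in_itv/= leey ltW. Qed.

(* Where [p] vanishes, [lne p] is [-oo] and the left-hand side
   is [0] because [+oo * 0 = 0]. *)
Lemma expeR_sub_lneM_le (R : realType) (h p : \bar R) (z : R) :
  0 <= p -> p \is a fin_num ->
  expeR (h - lne p - z%:E) * p <= expeR (h - z%:E).
Proof.
case: p => // p; rewrite lee_fin le_eqVlt => /predU1P[<- _|p0 _].
  by rewrite mule0 expeR_ge0.
rewrite lne_EFin//; case: h => [h| |] /=; rewrite ?leey ?mul0e//.
rewrite -EFinM lee_fin -{2}(lnK p0) -expRD ler_expR le_eqVlt.
by apply/orP; left; apply/eqP; ring.
Qed.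

(** This is [1 + t <= e^t] at [t = h - D - z]. Subtracting [m] makes the left side nonnegative, so
    that it can be integrated even when [h] takes the value [+oo]. *)
Lemma gibbs_pointwise (R : realType) (h D : \bar R) (z m : R) :
  m%:E <= h -> D \is a fin_num ->
  h - m%:E <= D + expeR (h - D - z%:E) + (z - 1 - m)%:E.
Proof.
case: D => // D; case: h => [h| |]// _ _.
rewrite /= -!EFinD lee_fin.
have := expR_ge1Dx (h - D - z); lra.
Qed.

Lemma relative_entropy_gtNy d (T : measurableType d) (R : realType)
    (theta gamma : probability T R) : -oo < relative_entropy theta gamma.
Proof.
rewrite /relative_entropy; case: asboolP => // -[_ iD].
by have := integrable_fin_num measurableT iD; rewrite fin_numE ltNye => /andP[].
Qed.

(** One half of the Donsker-Varadhan formula, for [h] bounded below and possibly infinite. *)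
Lemma gibbs_variational_le d (T : measurableType d) (R : realType)
    (theta gamma : probability T R) (h : T -> \bar R) (m : R) :
  measurable_fun [set: T] h -> (forall y, m%:E <= h y) ->
  \int[theta]_y h y <=
    relative_entropy theta gamma + lne (\int[gamma]_y expeR (h y)).
Proof.
move=> mh hm; have Z0 := integral_expeR_gt0 gamma mh hm.
have RNy := relative_entropy_gtNy theta gamma.
(* If [Z] or the entropy is [+oo], so is the right-hand side, because the other summand is not
   [-oo]. *)
have [Zy|Zfin] := eqVneq (\int[gamma]_y expeR (h y)) +oo.
  by rewrite Zy /= addey ?leey// gt_eqF.
move: RNy; rewrite /relative_entropy.
case: asboolP => [[dom iD] _|_ _]; last first.
  by rewrite addye ?leey// gt_eqF// lne_gtNy.
set D := log_density theta gamma in iD *.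
set Z := \int[gamma]_y expeR (h y) in Z0 Zfin *.
pose z := ln (fine Z).
have Zr : Z = (fine Z)%:E by rewrite fineK// ge0_fin_numE ?ltW// ltey.
have fZ0 : (0 < fine Z)%R by rewrite -lte_fin -Zr.
have -> : lne Z = z%:E by rewrite Zr lne_EFin.
have mD : measurable_fun [set: T] D by exact: measurable_int iD.
have mexp (u : T -> \bar R) : measurable_fun [set: T] u ->
    measurable_fun [set: T] (fun y => expeR (u y)).
  by move=> mu; apply: measurableT_comp => //; exact: measurable_expeR.
pose k y := expeR (h y - D y - z%:E).
have mk : measurable_fun [set: T] k.
  by apply: mexp; apply: emeasurable_funB => //; exact: emeasurable_funB.
have k0 y : 0 <= k y by exact: expeR_ge0.
(* A version of the density that is nonnegative and finite everywhere; it agrees [gamma]-almost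
   everywhere with the derivative inside [D]. *)
pose p := Radon_Nikodym_SigmaFinite.f theta gamma.
have p0 : forall y, 0 <= p y by exact: Radon_Nikodym_SigmaFinite.f_ge0.
have pfin : forall y, p y \is a fin_num.
  exact: Radon_Nikodym_SigmaFinite.f_fin_num.
have mp : measurable_fun [set: T] p.
  exact: measurable_int (Radon_Nikodym_SigmaFinite.f_integrable dom).
have ik1 : \int[theta]_y k y <= 1.
  rewrite -(Radon_Nikodym_SigmaFinite.change_of_variables dom k0 measurableT mk).
  have -> : 1 = \int[gamma]_y expeR (h y - z%:E).
    under eq_integral do rewrite -EFinN expeRD muleC.
    rewrite ge0_integralZl//; last 3 first.
    - exact: mexp.
    - by move=> *; exact: expeR_ge0.
    - exact: expeR_ge0.
    by rewrite -/Z Zr /= -EFinM expRN lnK// mulVf// gt_eqF.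
  apply: ae_ge0_le_integral => //.
  - by move=> y _; rewrite mule_ge0.
  - exact: emeasurable_funM.
  - by move=> y _; exact: expeR_ge0.
  - by apply: mexp; exact: emeasurable_funB.
  - have := ae_eq_Radon_Nikodym_SigmaFinite dom measurableT.
    apply: filterS => y /(_ I) py _.
    by rewrite /k /D /log_density -py; exact: expeR_sub_lneM_le.
have ik : theta.-integrable [set: T] k.
  apply/integrableP; split => //.
  under eq_integral do rewrite gee0_abs//.
  by rewrite (le_lt_trans ik1)// ltry.
pose r := (z - 1 - m)%R.
have icst : theta.-integrable [set: T] (fun=> r%:E).
  exact: finite_measure_integrable_cst.
have iDk := integrableD measurableT iD ik.
have iG := integrableD measurableT iDk icst.
pose G y := D y + k y + r%:E.
(* Integrability makes [D] finite [theta]-almost everywhere, which the pointwise bound requires. *)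
have hmG : {ae theta, forall y, [set: T] y -> h y - m%:E <= G y}.
  have := integrable_ae measurableT iD.
  by apply: filterS => y /(_ I) Dy _; exact: gibbs_pointwise.
have h0 y : 0 <= h y - m%:E by rewrite sube_ge0.
have mhm : measurable_fun [set: T] (fun y => h y - m%:E).
  exact: emeasurable_funB.
have mG : measurable_fun [set: T] G by exact: measurable_int iG.
have : \int[theta]_y (h y - m%:E) <= \int[theta]_y G y.
  (* [G] may be negative on a [theta]-null set; replacing it by its absolute value there gives
     monotonicity a nonnegative integrand. *)
  rewrite [leRHS](@ae_eq_integral _ _ _ _ _ (abse \o G))//.
  - apply: ae_ge0_le_integral => //.
    + by move=> y _ /=.
    + exact: measurableT_comp.
    + by apply: filterS hmG => y /[apply] /le_trans; apply; exact: lee_abs.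
  - exact: measurableT_comp.
  - apply: filterS hmG => y + _ => /(_ I) hG /=.
    by rewrite gee0_abs// (le_trans _ hG).
have -> : \int[theta]_y G y = \int[theta]_y D y + \int[theta]_y k y + r%:E.
  rewrite (integralD measurableT iDk icst) (integralD measurableT iD ik).
  by rewrite integral_probability_cst.
move=> hD.
have -> : \int[theta]_y h y = \int[theta]_y (h y - m%:E) + m%:E.
  rewrite -(ge0_integralD_cst _ (probability_setT theta))//.
  by apply: eq_integral => y _; rewrite subeK.
(* The bound 1 on the integral of [k] cancels the [-1] in [r], and the shift by [m] cancels its
   [-m], leaving [z]. *)
apply: (@le_trans _ _ (\int[theta]_y D y + 1 + r%:E + m%:E)).
  by rewrite leeD2r// (le_trans hD)// leeD2r// leeD2l.
suff -> : z%:E = 1 + r%:E + m%:E by rewrite !addeA.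
by rewrite -!EFinD /r; congr EFin; ring.
Qed.

(** * Application to the kernel integral of [c * F] *)

Theorem mainTheorem1 (R : realType) (X Y : ptopologicalType)
  (polX : polish R X) (polY : polish R Y)
  (gamma : probability (borel Y) R)
  (mu : R.-pker (borel Y) ~> (borel X))
  (F : X * Y -> R)
  (mF : measurable_fun [set: borel (X * Y)%type] (F : borel (X * Y)%type -> R))
  (bF : exists m : R, forall z : X * Y, (m <= F z)%R) :
  forall c : R, (0 < c)%R ->
    -oo < Lambda_bar1 gamma mu F c /\
    forall theta : probability (borel Y) R,
      \int[theta]_y \int[mu y]_x (F (x, y))%:E <=
        c^-1%:E * relative_entropy theta gamma + Lambda_bar1 gamma mu F c.
Proof.
move=> c c0; have [m mle] := bF.
(* The coordinates are swapped because the kernel goes from [Y] to [X], so its parameter comes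
   first. *)
have mFYX : measurable_fun [set: borel Y * borel X]
    (fun p : borel Y * borel X => F (p.2, p.1)).
  have mF2 := measurable_fun_borel_prod (polish_second_countable polX)
    (polish_second_countable polY) mF.
  exact: (measurableT_comp mF2 (@measurable_swap _ _ (borel Y) (borel X))).
pose k (p : borel Y * borel X) : \bar R := (F (p.2, p.1) - m)%:E.
have k0 p : 0 <= k p by rewrite lee_fin subr_ge0.
have mk : measurable_fun [set: borel Y * borel X] k.
  by apply/measurable_EFinP; apply: measurable_funB.
pose G (y : borel Y) := \int[mu y]_x k (y, x).
have G0 y : 0 <= G y by apply: integral_ge0.
have mG : measurable_fun [set: borel Y] G.
  exact: measurable_fun_integral_finite_kernel.
have mky y : measurable_fun [set: borel X] (fun x => k (y, x)).
  by apply: measurableT_comp => //; exact: measurable_pair1.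
(* Used twice: [r = c] gives the exponent [h], and [r = 1] gives the inner integral of the
   conclusion. *)
have intcF r y : (0 <= r)%R ->
    \int[mu y]_x (r * F (x, y))%:E = r%:E * G y + (r * m)%:E.
  move=> r0; rewrite -ge0_integralZl_EFin//.
  rewrite -(ge0_integralD_cst _ (prob_kernel y))//; last 2 first.
  - by move=> x; rewrite mule_ge0.
  - exact: measurable_funeM.
  by apply: eq_integral => x _; rewrite /k -EFinM -EFinD -mulrDr subrK.
have -> : Lambda_bar1 gamma mu F c =
    c^-1%:E * lne (\int[gamma]_y expeR (c%:E * G y + (c * m)%:E)).
  by rewrite /Lambda_bar1; under eq_integral do rewrite intcF ?ltW//.
set h := fun y => c%:E * G y + (c * m)%:E.
have mcG : measurable_fun [set: borel Y] (fun y => c%:E * G y).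
  exact: measurable_funeM.
have mh : measurable_fun [set: borel Y] h by exact: emeasurable_funD.
have hm y : (c * m)%:E <= h y by rewrite /h leeDr// mule_ge0// lee_fin ltW.
have LNy := lne_gtNy (integral_expeR_gt0 gamma mh hm).
split.
  move: LNy; rewrite -/h; case: (lne _) => [l _| _|//].
    by rewrite -EFinM ltNyr.
  by rewrite gt0_muley// lte_fin invr_gt0.
move=> theta; have RNy := relative_entropy_gtNy theta gamma.
(* Factoring out [c^-1] requires the sum to be defined, which holds since neither summand is
   [-oo]. *)
rewrite -muleDr//; last first.
  by rewrite /adde_def !negb_and (gt_eqF LNy) (gt_eqF RNy) !orbT.
have -> : \int[theta]_y \int[mu y]_x (F (x, y))%:E =
    c^-1%:E * \int[theta]_y h y.
  rewrite /h (ge0_integralD_cst _ (probability_setT theta))//; last first.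
    by move=> y; rewrite mule_ge0// lee_fin ltW.
  rewrite ge0_integralZl_EFin// ?ltW// muleDr ?fin_num_adde_defl//.
  rewrite muleA -!EFinM mulVf ?gt_eqF// mul1e mulKf ?gt_eqF//.
  rewrite -(ge0_integralD_cst _ (probability_setT theta))//.
  apply: eq_integral => y _.
  have := intcF 1%R y ler01; rewrite mul1e mul1r => <-.
  by apply: eq_integral => x _; rewrite mul1r.
rewrite lee_wpmul2l ?lee_fin ?invr_ge0 ?(ltW c0)//.
exact: gibbs_variational_le mh hm.
Qed.
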